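(* For each integer $n\geq 1$, the $D_{\omega^n}(\boldsymbol{\Sigma}^1_1)$-complete tree language $\mathcal{L}_n$ is Wadge reducible to the game tree language $W_{(0,2)}$, i.e. $\mathcal{L}_n\leq_W W_{(0,2)}$. In particular, the language $W_{(0,2)}$ is not in any class $D_\alpha(\boldsymbol{\Sigma}^1_1)$ for $\alpha<\omega^\omega$.
   Context: **Trees.** For a finite alphabet $\Sigma$, $T_\Sigma^\omega$ is the set of all functions $t:\{l,r\}^\star\to\Sigma$ (infinite binary trees labelled in $\Sigma$; the root is the empty word $\lambda$). For $u\in\{l,r\}^\star$, $t_u\in T_\Sigma^\omega$ is the subtree $t_u(v)=t(u\cdot v)$. A path of $t$ is an infinite sequence $t(u_0)t(u_1)\cdots$ of labels along an infinite branch, where $u_0=\lambda$ and $u_{i+1}\in\{u_il,u_ir\}$ for all $i$. **Topology.** $\Sigma^\omega$ (infinite words) and $T_\Sigma^\omega$ carry the Cantor (product of discrete) topology. $\boldsymbol{\Sigma}^1_1$ is the class of analytic sets. **Difference hierarchy.** A countable ordinal is even if it is of the form $\gamma+m$ with $\gamma$ equal to $0$ or a limit ordinal and $m$ an even non-negative integer; otherwise it is odd. For an ordinal $\eta<\omega_1$ and an increasing sequence $(A_\theta)_{\theta<\eta}$ of subsets of a space $X$, $D_\eta[(A_\theta)_{\theta<\eta}]$ is the set of $x\in X$ such that $x\in A_\theta\setminus\bigcup_{\theta'<\theta}A_{\theta'}$ for some $\theta<\eta$ whose parity is opposite to that of $\eta$. For $X=\Sigma^\omega$ or $X=T_\Sigma^\omega$,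 $D_\eta(\boldsymbol{\Sigma}^1_1)$ is the class of all sets $D_\eta[(A_\theta)_{\theta<\eta}]$ with every $A_\theta\subseteq X$ in $\boldsymbol{\Sigma}^1_1$. **Reducibility and completeness.** $E\leq_W F$ (Wadge reducibility) means $E=f^{-1}(F)$ for some continuous function $f$ between the ambient spaces. A set $F$ (in a space $\Sigma^\omega$ or $T_\Sigma^\omega$) is $D_\eta(\boldsymbol{\Sigma}^1_1)$-complete if for every finite alphabet $Y$ and every $E\subseteq Y^\omega$: $E\in D_\eta(\boldsymbol{\Sigma}^1_1)$ iff $E\leq_W F$. **The languages $\mathcal{L}$ and $\mathcal{L}_n$.** $\mathcal{L}\subseteq T^\omega_{\{0,1\}}$ is the set of trees having at least one path containing infinitely many letters $1$. For non-negative integers write $\mathrm{Ord}(a_{n-1},\ldots,a_0)=\omega^{n-1}\cdot a_{n-1}+\cdots+\omega\cdot a_1+a_0$. For $n=1$, $$\mathcal{L}_1=\{t\in T^\omega_{\{0,1\}}\mid \exists m\geq 0\ \ t_{l^m\cdot r}\in\mathcal{L}\text{ and }\min\{m\geq 0\mid t_{l^m\cdot r}\in\mathcal{L}\}\text{ is odd}\}.$$ For $n\geq 2$, $\mathcal{L}_n$ is the set of $t\in T^\omega_{\{0,1\}}$ for which there exist integers $a_{n-1},\ldots,a_0\geq 0$ such that: (1) $t_{l^{a_{n-1}}\cdot r\cdot l^{a_{n-2}}\cdot r\cdots l^{a_0}\cdot r}\in\mathcal{L}$ and $\mathrm{Ord}(a_{n-1},\ldots,a_0)$ is odd; (2) for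 all integers $b_{n-1},\ldots,b_0\ge 0$ with $\mathrm{Ord}(b_{n-1},\ldots,b_0)<\mathrm{Ord}(a_{n-1},\ldots,a_0)$, the tree $t_{l^{b_{n-1}}\cdot r\cdot l^{b_{n-2}}\cdot r\cdots l^{b_0}\cdot r}$ is not in $\mathcal{L}$. **Game tree language $W_{(0,2)}$.** Let $\Sigma_{(0,2)}=\{\exists,\forall\}\times\{0,1,2\}$; for a letter $a$ write $a=(a_1,a_2)$. For $t\in T^\omega_{\Sigma_{(0,2)}}$, the parity game $G(t)$ is played by Eve and Adam with positions $v\in\{l,r\}^\star$, starting at $\lambda$. At position $v$, Eve moves if $t(v)_1=\exists$ and Adam moves if $t(v)_1=\forall$; a move goes from $v$ to $vl$ or $vr$. Eve wins an infinite play $v_0,v_1,\ldots$ iff $\limsup_{k\to\infty}t(v_k)_2$ is even; otherwise Adam wins. $W_{(0,2)}\subseteq T^\omega_{\Sigma_{(0,2)}}$ is the set of trees $t$ such that Eve has a winning strategy in $G(t)$. *)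

(* Defs.v *)
From HB Require Import structures.
From mathcomp Require Import all_boot all_order.
From mathcomp Require Import all_classical topology.
Set Implicit Arguments.
Unset Strict Implicit.
Unset Printing Implicit Defensive.
Import Order.TTheory.

Local Open Scope classical_set_scope.

(* An ordinal is given by a well-ordered type, and an ordinal below it by an
   element theta, which stands for the order type of its initial segment. *)
Record countable_ordinal : Type := CountableOrdinal {
  ord_disp : Order.disp_t;
  ord_carrier :> orderType ord_disp;
  ord_wf : well_founded (fun x y : ord_carrier => (x < y)%O);
  ord_countable : countable [set: ord_carrier]
}.

Definition segment (eta : countable_ordinal) (theta : eta) : set eta :=
  [set x | (x < theta)%O].

(* For P an initial segment of a well-order, the order type of P is gamma + m
   with gamma zero or limit: the last m points of P form the list s, and the
   rest of P has no greatest element. *)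
Definition limit_plus d (T : orderType d) (P : set T) (m : nat) : Prop :=
  exists s : seq T,
    [/\ uniq s /\ size s = m,
        forall x, x \in s -> P x,
        forall x y, x \in s -> P y -> (x < y)%O -> y \in s
      & forall x, P x -> x \notin s ->
          exists y, [/\ P y, y \notin s & (x < y)%O]].

Definition even_type d (T : orderType d) (P : set T) : Prop :=
  exists m : nat, ~~ odd m /\ limit_plus P m.

Definition odd_type d (T : orderType d) (P : set T) : Prop := ~ even_type P.

(* alpha < beta: alpha is isomorphic to a proper initial segment of beta. *)
Definition ord_lt (alpha beta : countable_ordinal) : Prop :=
  exists (b : beta) (f : alpha -> beta),
    {mono f : x y / (x < y)%O} /\ range f = segment b.

(* omega^n = omega * ... * omega is the lexicographic order on n-tuples of
   naturals, most significant coordinate first; the tuple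
   (a_{n-1}, ..., a_0) is the ordinal
   omega^{n-1} * a_{n-1} + ... + omega * a_1 + a_0 below omega^n. *)
Lemma tuplelexi_wf n :
  well_founded (fun x y : n.-tuplelexi nat => (x < y)%O).
Proof.
elim: n => [|n IHn].
  move=> x; apply: Acc_intro => y.
  by rewrite (tuple0 (x : 0.-tuple nat)) (tuple0 (y : 0.-tuple nat)) ltxx.
suff H a (x : n.-tuplelexi nat) :
    Acc (fun x y : n.+1.-tuplelexi nat => (x < y)%O) (cons_tuple a x).
  by case/tupleP => a x; exact: H.
elim/ltn_ind: a x => a IHa x.
elim: {x}(IHn x) => x _ IHx.
apply: Acc_intro; case/tupleP => b y lt_yx.
have: (b :: y < a :: x :> seqlexi nat)%O := lt_yx.
rewrite ltxi_cons => /andP[le_ba].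
have [lt_ba _|le_ab /= lt_yx'] := ltP b a; first exact: IHa.
have -> : b = a by apply: le_anti; rewrite le_ba.
exact: IHx.
Qed.

Lemma tuplelexi_countable n : countable [set: n.-tuplelexi nat].
Proof. exact: (@countableP (n.-tuple nat)). Qed.

Definition omega_pow (n : nat) : countable_ordinal :=
  CountableOrdinal (@tuplelexi_wf n) (@tuplelexi_countable n).

(* omega^omega is the supremum of the omega^n. *)
Definition lt_omega_omega (alpha : countable_ordinal) : Prop :=
  exists n : nat, ord_lt alpha (omega_pow n).

Definition baire_space := {ptws nat -> nat}.

Definition words (Sigma : finType) := {ptws nat -> discrete_topology Sigma}.

Local Notation l := false (only parsing).
Local Notation r := true (only parsing).

Definition trees (Sigma : finType) :=
  {ptws seq bool -> discrete_topology Sigma}.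

(* Boldface Sigma^1_1: projections along the Baire space of closed sets. *)
Definition analytic (X : topologicalType) (A : set X) : Prop :=
  exists C : set (X * baire_space),
    closed C /\ A = [set x | exists y, C (x, y)].

Definition Dset (eta : countable_ordinal) (X : Type) (A : eta -> set X) :
    set X :=
  [set x | exists theta : eta,
     [/\ A theta x,
         forall theta' : eta, (theta' < theta)%O -> ~ A theta' x
       & odd_type (segment theta) <-> even_type [set: eta]]].

Definition Dclass (eta : countable_ordinal) (X : topologicalType)
    (E : set X) : Prop :=
  exists A : eta -> set X,
    [/\ forall theta' theta : eta,
          (theta' <= theta)%O -> A theta' `<=` A theta,
        forall theta : eta, analytic (A theta)
      & E = Dset A].

Definition wadge (X Y : topologicalType) (E : set X) (F : set Y) : Prop :=
  exists f : X -> Y, continuous f /\ E = f @^-1` F.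

Definition Dcomplete (eta : countable_ordinal) (X : topologicalType)
    (F : set X) : Prop :=
  forall (Y : finType) (E : set (words Y)), Dclass eta E <-> wadge E F.

Definition subtree (Sigma : finType) (t : trees Sigma) (u : seq bool) :
    trees Sigma := fun v => t (u ++ v).

Definition branch (u : nat -> seq bool) : Prop :=
  u 0 = [::] /\
  forall i, u i.+1 = rcons (u i) l \/ u i.+1 = rcons (u i) r.

(* The alphabet {0,1} is bool, with 1 = true. *)
Definition lang : set (trees bool) :=
  [set t | exists u, branch u /\ infinite_set [set i | t (u i) = true]].

Definition lang1 : set (trees bool) :=
  [set t | exists m : nat,
     [/\ lang (subtree t (rcons (nseq m l) r)),
         forall k, lang (subtree t (rcons (nseq k l) r)) -> m <= k
       & odd m]].

(* The word l^{a_{n-1}} r l^{a_{n-2}} r ... l^{a_0} r *)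
Definition address (a : seq nat) : seq bool :=
  flatten [seq rcons (nseq m l) r | m <- a].

Definition lang_ge2 (n : nat) : set (trees bool) :=
  [set t | exists a : omega_pow n,
     (lang (subtree t (address (a : n.-tuple nat))) /\
      odd_type (segment a)) /\
     forall b : omega_pow n, (b < a)%O ->
       ~ lang (subtree t (address (b : n.-tuple nat)))].

Definition langn (n : nat) : set (trees bool) :=
  if n == 1 then lang1 else lang_ge2 n.

(* The first component is true for the player Eve (exists), false for Adam
   (forall). *)
Definition Sigma02 : finType := (bool * 'I_3)%type.

Definition is_limsup (u : nat -> nat) (m : nat) : Prop :=
  exists s : nat -> nat,
    (forall N, supremums [set u k | k in [set k | N <= k]] (s N)) /\
    infimums (range s) m.

(* A position records the whole history of the play, so a strategy of Eve
   is a choice of a direction at each position. *)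
Definition follows (t : trees Sigma02) (sigma : seq bool -> bool)
    (v : nat -> seq bool) : Prop :=
  forall k, (t (v k)).1 = true -> v k.+1 = rcons (v k) (sigma (v k)).

Definition eve_wins_play (t : trees Sigma02) (v : nat -> seq bool) : Prop :=
  exists m : nat,
    is_limsup (fun k => nat_of_ord (t (v k)).2) m /\ ~~ odd m.

Definition W02 : set (trees Sigma02) :=
  [set t | exists sigma : seq bool -> bool,
     forall v, branch v -> follows t sigma v -> eve_wins_play t v].

(* Main.v *)
(* The class of sets reducible to [W02] contains the analytic sets and their
   complements, and is closed under countable unions and intersections: let
   Eve (resp. Adam) pick an index [k] by walking [k] steps along the leftmost
   branch, whose priority 1 (resp. 0) makes her (resp. him) lose when no index
   is ever picked.  Since [langn n] is built from preimages of the analytic set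
   [lang] by such operations, it reduces to [W02].

   If [W02] were in [D_eta] for some countable [eta], so would be the diagonal
   set of a parametrization of all [eta]-sequences of analytic sets, as it too
   is a countable combination of analytic and coanalytic sets.

   For completeness, [lang] is shown to be complete analytic; the reductions of
   the sets [A theta] to [lang] are glued by hanging them at the nodes
   [address theta], which form a prefix code. *)
Require Import Defs.
From mathcomp Require Import all_boot all_order.
From mathcomp Require Import all_classical topology.
Set Implicit Arguments.
Unset Strict Implicit.
Unset Printing Implicit Defensive.
Import Order.TTheory.
Local Open Scope classical_set_scope.

(** * Locally constant maps and pointwise convergence *)

Section LocallyConstant.
Variable X : topologicalType.

(** Continuity into a discrete [A], stated without a topology on [A], so that values may be
    sequences or propositions. *)
Definition locally_constant A (g : X -> A) : Prop :=
  forall x, \forall x' \near x, g x' = g x.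

Lemma locally_constant_cst A (a : A) : locally_constant (fun=> a).
Proof. by move=> x; exact: nearW. Qed.

(** Serves for reading a point at a position that is itself computed from the point: near [x], a
    single [h a] is in play. *)
Lemma locally_constant_bind A B (g : X -> A) (h : A -> X -> B) :
  locally_constant g -> (forall a, locally_constant (h a)) ->
  locally_constant (fun x => h (g x) x).
Proof.
move=> lcg lch x; apply: filterS2 (lcg x) (lch (g x) x).
by move=> x' /= ->.
Qed.

Lemma locally_constant_comp A B (phi : A -> B) (g : X -> A) :
  locally_constant g -> locally_constant (phi \o g).
Proof. by move=> lcg x; apply: filterS (lcg x) => x' /= ->. Qed.

Lemma locally_constant_mkseq A (h : nat -> X -> A) k :
  (forall i, locally_constant (h i)) ->
  locally_constant (fun x => mkseq (h ^~ x) k).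
Proof.
move=> lch; elim: k => [|k IHk]; first exact: locally_constant_cst.
move=> x; apply: filterS2 (IHk x) (lch k x) => x' /= e1 e2.
by rewrite !mkseqS e1 e2.
Qed.

Lemma closed_forall (I : Type) (P : I -> X -> Prop) :
  (forall i, locally_constant (P i)) -> closed [set x | forall i, P i x].
Proof.
move=> lcP; rewrite -openC openE => x /= /existsNP[i nPi].
by apply: filterS (lcP i x) => x' /= e /(_ i); rewrite e.
Qed.

End LocallyConstant.

Lemma locally_constant_preimage (X Y : topologicalType) (f : X -> Y) A
    (g : Y -> A) :
  continuous f -> locally_constant g -> locally_constant (g \o f).
Proof. by move=> fc lcg x; exact: fc (lcg (f x)). Qed.

Section PointwiseTopology.
Variables (I : eqType) (T : discreteTopologicalType).

Lemma locally_constant_eval (i : I) :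
  locally_constant (fun x : {ptws I -> T} => x i).
Proof.
move=> x; apply: (@proj_continuous I (fun=> T) i x [set c | c = x i]).
by rewrite nbhs_principalE; exact/principal_filterP.
Qed.

Lemma cvg_ptws (F : set_system {ptws I -> T}) (x : {ptws I -> T}) :
  Filter F -> (forall i, F [set x' | x' i = x i]) -> F --> x.
Proof.
move=> FF Fx; apply/cvg_sup => i A.
rewrite nbhsE => -[_ [[U _ <-] Uxi] UA].
by apply: filterS (Fx i) => x' /= e; apply: UA; rewrite /= e.
Qed.

Lemma locally_constant_continuous (X : topologicalType)
    (f : X -> {ptws I -> T}) :
  (forall i, locally_constant (f ^~ i)) -> continuous f.
Proof. by move=> lcf x; apply: cvg_ptws => i; exact: lcf. Qed.

Lemma continuous_locally_constant (X : topologicalType)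
    (f : X -> {ptws I -> T}) i :
  continuous f -> locally_constant (f ^~ i).
Proof.
by move=> fc; exact: locally_constant_preimage fc (locally_constant_eval i).
Qed.

End PointwiseTopology.

(** The sets containing a cylinder around [x] form a filter that converges to [x] coordinatewise, so
    it contains every neighbourhood. *)
Lemma nbhs_ptws_nat (T : discreteTopologicalType) (x : {ptws nat -> T}) A :
  nbhs x A -> exists k, forall x', (forall i, i < k -> x' i = x i)%N -> A x'.
Proof.
pose F : set_system {ptws nat -> T} := [set A : set {ptws nat -> T} |
  exists k, forall x', (forall i, i < k -> x' i = x i)%N -> A x'].
have FF : Filter F.
  split; first by exists 0.
    move=> P Q [k hk] [m hm]; exists (maxn k m) => x' e.
    by split; [apply: hk|apply: hm] => i lt_i; apply: e;
      rewrite leq_max lt_i ?orbT.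
  by move=> P Q PQ [k hk]; exists k => x' /hk/PQ.
suff Fx : F --> x by exact: Fx.
by apply: cvg_ptws => i; exists i.+1 => x'; exact.
Qed.

(** Otherwise a product of two cylinders around [(x, y)] would miss [C], and agreement up to the
    longer of the two prefixes contradicts this. *)
Lemma closed_agree (T S : discreteTopologicalType)
    (C : set ({ptws nat -> T} * {ptws nat -> S})) (x : {ptws nat -> T})
    (y : {ptws nat -> S}) :
  closed C ->
  (forall k, exists z, [/\ C z, forall i, (i < k)%N -> z.1 i = x i &
                           forall i, (i < k)%N -> z.2 i = y i]) ->
  C (x, y).
Proof.
move=> Ccl agr; apply: contrapT => nCxy.
have : nbhs (x, y) (~` C) by apply: open_nbhs_nbhs; split=> //; rewrite openC.
case=> -[U V] /= [/nbhs_ptws_nat[k1 hU] /nbhs_ptws_nat[k2 hV]] UV.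
have [[x' y'] /= [Cz ex ey]] := agr (maxn k1 k2).
apply: (UV (x', y')) => //; split=> /=.
  by apply: hU => i lti; apply: ex; rewrite leq_max lti.
by apply: hV => i lti; apply: ey; rewrite leq_max lti orbT.
Qed.

Lemma continuous_pair (X Y Z : topologicalType) (f : X -> Y) (g : X -> Z) :
  continuous f -> continuous g -> continuous (fun x => (f x, g x)).
Proof. by move=> fc gc x; apply: cvg_pair; [exact: fc|exact: gc]. Qed.

Lemma continuous_fst (X Y : topologicalType) : continuous (@fst X Y).
Proof. by move=> x; exact: cvg_fst. Qed.

Lemma continuous_snd (X Y : topologicalType) : continuous (@snd X Y).
Proof. by move=> x; exact: cvg_snd. Qed.

Lemma continuousT_comp (X Y Z : topologicalType) (f : Y -> Z) (g : X -> Y) :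
  continuous f -> continuous g -> continuous (f \o g).
Proof. by move=> fc gc x; apply: continuous_comp; [exact: gc|exact: fc]. Qed.

Lemma locally_constant_fst (I : eqType) (T : discreteTopologicalType)
    (X : topologicalType) (i : I) :
  locally_constant (fun z : {ptws I -> T} * X => z.1 i).
Proof.
apply: locally_constant_preimage (@locally_constant_eval _ _ i).
exact: continuous_fst.
Qed.

Lemma locally_constant_snd (I : eqType) (T : discreteTopologicalType)
    (X : topologicalType) (i : I) :
  locally_constant (fun z : X * {ptws I -> T} => z.2 i).
Proof.
apply: locally_constant_preimage (@locally_constant_eval _ _ i).
exact: continuous_snd.
Qed.

(** * Analytic sets *)

(** An injection of [D] into [nat] reindexes the union; numbers outside its image contribute
    [set0]. *)
Lemma countable_bigcup_closed X (P : set X -> Prop) :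
  P set0 ->
  (forall S : nat -> set X, (forall k, P (S k)) -> P (\bigcup_k S k)) ->
  forall I (D : set I) (S : I -> set X), countable D ->
    (forall i, D i -> P (S i)) -> P (\bigcup_(i in D) S i).
Proof.
move=> P0 PU I D S /countable_injP[g g_inj] PS.
have -> : \bigcup_(i in D) S i =
    \bigcup_k \bigcup_(i in [set i | D i /\ g i = k]) S i.
  apply/seteqP; split=> [x [i Di Six]|x [k _ [i [Di _] Six]]]; last by exists i.
  by exists (g i) => //; exists i.
apply: PU => k.
have [[i Di gik]|nik] := pselect (exists2 i, D i & g i = k); last first.
  suff -> : [set i | D i /\ g i = k] = set0 by rewrite bigcup_set0.
  by apply/seteqP; split=> // i [Di gik]; case: nik; exists i.
suff -> : [set i | D i /\ g i = k] = [set i] by rewrite bigcup_set1; exact: PS.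
apply/seteqP; split=> [j [Dj gjk]|_ ->] //=.
by apply: g_inj; rewrite ?inE // gjk.
Qed.

Lemma analytic_preimage (X Y : topologicalType) (f : X -> Y) (A : set Y) :
  continuous f -> analytic A -> analytic (f @^-1` A).
Proof.
move=> fc [C [Ccl ->]].
exists ((fun z => (f z.1, z.2)) @^-1` C); split=> //.
apply: (continuous_closedP _).1 Ccl; apply: continuous_pair.
  exact: continuousT_comp fc (@continuous_fst _ _).
exact: continuous_snd.
Qed.

Lemma analytic0 (X : topologicalType) : analytic (@set0 X).
Proof.
exists set0; split; first exact: closed0.
by apply/seteqP; split=> // x [].
Qed.

(** The head of the new witness names the index [k], its tail is a witness for [A k]. *)
Lemma analytic_bigcup_nat (X : topologicalType) (A : nat -> set X) :
  (forall k, analytic (A k)) -> analytic (\bigcup_k A k).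
Proof.
move=> /choice[C CA].
pose tl (y : baire_space) : baire_space := fun i => y i.+1.
have lc_eval i : locally_constant (fun z : X * baire_space => z.2 i).
  exact: locally_constant_snd.
exists [set z | C (z.2 0) (z.1, tl z.2)]; split; last first.
  apply/seteqP; split=> [x [k _]|x [y Cy]].
    rewrite (CA k).2 => -[y Cxy].
    by exists (fun i => if i is i'.+1 then y i' else k).
  by exists (y 0) => //; rewrite (CA _).2; exists (tl y).
rewrite -openC openE => z /= nCz.
have tlc : continuous (fun z : X * baire_space => (z.1, tl z.2)).
  apply: continuous_pair; first exact: continuous_fst.
  by apply: locally_constant_continuous => i; exact: lc_eval.
have /tlc : nbhs (z.1, tl z.2) (~` C (z.2 0)).
  by apply: open_nbhs_nbhs; split=> //; rewrite openC; exact: (CA _).1.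
by apply: filterS2 (lc_eval 0 z) => z' /= ->.
Qed.

Definition analytic_bigcup X :=
  countable_bigcup_closed (@analytic0 X) (@analytic_bigcup_nat X).

Definition unbounded (A : set nat) : Prop :=
  forall N, exists2 k, (N <= k)%N & A k.

Lemma infinite_set_unbounded (A : set nat) : infinite_set A <-> unbounded A.
Proof.
split=> [infA N|unbA /finite_seqP[B AB]].
  apply: contrapT => nA; apply: infA; apply: sub_finite_set (finite_II N).
  move=> k Ak /=; rewrite ltnNge; apply/negP => le_Nk; apply: nA.
  by exists k.
have [k le_k] := unbA (\max_(i <- B) i).+1.
rewrite AB /= => Bk; move: le_k; rewrite ltnNge => /negP; apply.
exact: leq_bigmax_seq.
Qed.

(** From here on a branch is handled as its sequence of directions. *)
Lemma branchP u : branch u <-> exists b : nat -> bool, u = mkseq b.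
Proof.
split=> [[u0 uS]|[b ->]].
  exists (fun i => last false (u i.+1)); apply/funext; elim=> [|i IHi] //.
  by rewrite mkseqS -IHi; case: (uS i) => ->; rewrite last_rcons.
by split=> // i; rewrite mkseqS; case: (b i); [right|left].
Qed.

Lemma langP t :
  lang t <-> exists b, unbounded [set i | t (mkseq b i) = true].
Proof.
split=> [[u [/branchP[b ->] /infinite_set_unbounded unb]]|[b unb]].
  by exists b.
by exists (mkseq b); split;
  [apply/branchP; exists b|apply/infinite_set_unbounded].
Qed.

(* The witness [y] interleaves a branch (the parities) and occurrence times of
   the letter 1 on it (the halves). *)
Lemma lang_analytic : analytic lang.
Proof.
pose X : topologicalType := (trees bool * baire_space)%type.
pose P N (z : X) :=
  (N <= (z.2 N)./2)%N /\ z.1 (mkseq (odd \o z.2) (z.2 N)./2) = true.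
exists [set z | forall N, P N z]; split.
  apply: closed_forall => N.
  have lc_eval i : locally_constant (fun z : X => z.2 i).
    exact: locally_constant_snd.
  apply: (@locally_constant_bind X _ _ (fun z => z.2 N) (fun a z =>
    (N <= a./2)%N /\ z.1 (mkseq (odd \o z.2) a./2) = true)) => // a.
  apply: (@locally_constant_bind X _ _ (fun z => mkseq (odd \o z.2) a./2)
    (fun s z => (N <= a./2)%N /\ z.1 s = true)).
    apply: (@locally_constant_mkseq X _ (fun i z => odd (z.2 i))) => i.
    exact: locally_constant_comp (lc_eval i).
  move=> s; apply: (locally_constant_comp (fun c => (N <= a./2)%N /\ c = true)
    (g := fun z : X => z.1 s)).
  exact: locally_constant_fst.
apply/seteqP; split=> t.
  move=> /langP[b unb].
  have /choice[m mP] N : exists k, (N <= k)%N /\ t (mkseq b k) = true.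
    by have [k] := unb N; exists k.
  have ob : odd \o (fun i => b i + (m i).*2)%N = b.
    by apply/funext => i /=; rewrite oddD odd_double addbF oddb.
  exists (fun i => b i + (m i).*2)%N => N.
  by rewrite /P /= ob half_bit_double; exact: mP.
move=> [y yP]; apply/langP; exists (odd \o y) => N.
by have [le_N ty] := yP N; exists (y N)./2.
Qed.

(** * Addresses as a prefix code, and the completeness of [lang] *)

Lemma address_cons m r : address (m :: r) = nseq m false ++ true :: address r.
Proof. by rewrite /address /= -cats1 -catA. Qed.

Lemma nseq_true_inj m1 m2 s1 s2 :
  nseq m1 false ++ true :: s1 = nseq m2 false ++ true :: s2 ->
  m1 = m2 /\ s1 = s2.
Proof.
elim: m1 m2 => [|m1 IHm] [|m2] //= [].
  by move=> ->.
by move=> /IHm[-> ->].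
Qed.

(** Each [true] closes one block, so an address is decoded uniquely from the left. *)
Lemma address_prefix r1 r2 w1 w2 :
  address r1 ++ w1 = address r2 ++ w2 -> (size r1 <= size r2)%N ->
  r1 = take (size r1) r2.
Proof.
elim: r1 r2 => [|m1 r1 IHr] [|m2 r2] //=.
rewrite !address_cons -!catA !cat_cons => /nseq_true_inj[-> e] le_r.
by rewrite -IHr.
Qed.

Lemma address_inj r1 r2 w1 w2 :
  address r1 ++ w1 = address r2 ++ w2 -> size r1 = size r2 ->
  r1 = r2 /\ w1 = w2.
Proof.
move=> e es; have := address_prefix e.
rewrite es take_size => /(_ (leqnn _)) e'.
by move: e; rewrite e' => /eqP; rewrite eqseq_cat // eqxx => /eqP.
Qed.

Lemma size_address r : (size r <= size (address r))%N.
Proof.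
elim: r => [|m r IHr] //.
by rewrite address_cons size_cat /= addnS ltnS (leq_trans IHr) ?leq_addl.
Qed.

Lemma address_cat r1 r2 : address (r1 ++ r2) = address r1 ++ address r2.
Proof. by rewrite /address map_cat flatten_cat. Qed.

(* The tree [f x] carries the letter 1 exactly at the addresses of the finite
   prefixes of some [y'] such that [(x', y') \in C] for some [x'] agreeing with
   [x] on as many letters; as [C] is closed, a branch through infinitely many
   of them spells out some [y] with [(x, y) \in C]. *)
Lemma analytic_wadge_lang (Y : finType) (A : set (words Y)) :
  analytic A -> wadge A lang.
Proof.
case=> C [Ccl ->].
pose appr (x : words Y) (r : seq nat) := exists z : words Y * baire_space,
  [/\ C z, forall i, (i < size r)%N -> z.1 i = x i & r = mkseq z.2 (size r)].
pose f (x : words Y) : trees bool := fun v =>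
  `[< exists2 r, appr x r & v = address r >].
have apprE x x' r : (forall i, (i < size r)%N -> x' i = x i) ->
    appr x r -> appr x' r.
  by move=> e [z [Cz ez rz]]; exists z; split=> // i lti; rewrite ez ?e.
exists f; split.
  apply: locally_constant_continuous => v x.
  (* A sequence is no longer than its address, so the first [size v] letters of [x] decide the label
     at [v]. *)
  have : \forall x' \near x, mkseq x' (size v) = mkseq x (size v).
    apply: (@locally_constant_mkseq (words Y) _ (fun i x => x i)) => i.
    exact: locally_constant_eval.
  apply: filterS => x' /= e.
  have {}e i : (i < size v)%N -> x' i = x i.
    by move=> lti; rewrite -(nth_mkseq (x i) x' lti) e nth_mkseq.
  apply/asbool_equiv_eq; split=> -[r xr vr]; exists r => //;
    apply: apprE xr => i lti; rewrite e // vr;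
    exact: leq_trans lti (size_address r).
apply/seteqP; split=> x /=.
  move=> [y Cxy]; apply/langP.
  pose ad k := address (mkseq y k).
  have le_ad k : (k <= size (ad k))%N.
    by rewrite (leq_trans _ (size_address _)) ?size_mkseq.
  have adD k j : exists w, ad (k + j)%N = ad k ++ w.
    rewrite /ad /mkseq iotaD map_cat address_cat; eexists; reflexivity.
  (* The nodes [ad k] lie on one branch; its bit [i] can be read off [ad i.+1], which has length at
     least [i.+1]. *)
  pose b i := nth false (ad i.+1) i.
  have nth_ad k i : (i < size (ad k))%N -> nth false (ad k) i = b i.
    move=> lti; rewrite /b; have [le_k|/ltnW le_i] := leqP k i.+1.
      have [w] := adD k (i.+1 - k)%N; rewrite subnKC // => ->.
      by rewrite nth_cat lti.
    have [w] := adD i.+1 (k - i.+1)%N; rewrite subnKC // => ->.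
    by rewrite nth_cat le_ad.
  exists b => N; exists (size (ad N)) => //=.
  have -> : mkseq b (size (ad N)) = ad N.
    apply: (@eq_from_nth _ false); rewrite size_mkseq // => i lti.
    by rewrite nth_mkseq // nth_ad.
  apply/asboolP; exists (mkseq y N) => //.
  by exists (x, y); rewrite size_mkseq.
move=> /langP[b unb].
pose onb r := exists i, mkseq b i = address r.
have onb_prefix r1 r2 : onb r1 -> onb r2 -> (size r1 <= size r2)%N ->
    r1 = take (size r1) r2.
  move=> [i1 e1] [i2 e2].
  have [w1 h1] : exists w, mkseq b (maxn i1 i2) = mkseq b i1 ++ w.
    by rewrite -(subnKC (leq_maxl i1 i2)) /mkseq iotaD map_cat; eexists.
  have [w2 h2] : exists w, mkseq b (maxn i1 i2) = mkseq b i2 ++ w.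
    by rewrite -(subnKC (leq_maxr i1 i2)) /mkseq iotaD map_cat; eexists.
  by apply: (@address_prefix _ _ w1 w2); rewrite -e1 -e2 -h1 -h2.
(* The next marked node strictly below [address r] encodes a longer sequence: otherwise that
   sequence would be a prefix of [r], with an address no deeper than that of [r]. *)
have long k : exists r, [/\ appr x r, onb r & (k <= size r)%N].
  elim: k => [|k [r [xr [i br] ltr]]].
    have [i _ /asboolP[r xr br]] := unb 0.
    by exists r; split=> //; exists i.
  have [i' lti' /asboolP[r' xr' br']] := unb i.+1.
  exists r'; split=> //; first by exists i'.
  rewrite (leq_ltn_trans ltr) // ltnNge; apply/negP => le_r'.
  have : r' = take (size r') r by apply: onb_prefix => //; [exists i'|exists i].
  move=> er'; have := lti'; rewrite -(size_mkseq b i') br' er'.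
  have <- : size (mkseq b i) = i by rewrite size_mkseq.
  rewrite br -{1}(cat_take_drop (size r') r) address_cat.
  by rewrite size_cat ltnNge leq_addr.
have /choice[rr rrP] := long.
(* The sequences found on the branch are prefixes of one another, and [y] is their limit; [rr k.+1]
   is long enough to have an entry [k], so the default 0 is never read. *)
pose y : baire_space := fun k => nth 0 (rr k.+1) k.
have rrE k : (forall i, i < k -> nth 0 (rr k) i = y i)%N.
  move=> i lti; have [_ on1 le1] := rrP k; have [_ on2 le2] := rrP i.+1.
  rewrite /y; have [le_r|/ltnW le_r] := leqP (size (rr k)) (size (rr i.+1)).
    by rewrite (onb_prefix _ _ on1 on2 le_r) nth_take // (leq_trans lti le1).
  by rewrite (onb_prefix _ _ on2 on1 le_r) nth_take.
exists y; apply: (closed_agree (C := C)) => // k.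
have [[z [Cz ex ey]] _ le_k] := rrP k.
exists z; split=> // i lti; first by apply: ex; exact: leq_trans lti le_k.
by rewrite -(rrE k) // ey nth_mkseq // (leq_trans lti le_k).
Qed.

Lemma wadge_trans (X Y Z : topologicalType) (E : set X) (F : set Y)
    (G : set Z) :
  wadge E F -> wadge F G -> wadge E G.
Proof.
move=> [f [fc ->]] [g [gc ->]].
by exists (g \o f); split=> //; exact: continuousT_comp.
Qed.

Lemma wadge_preimage (X Y : topologicalType) (f : X -> Y) (F : set Y) :
  continuous f -> wadge (f @^-1` F) F.
Proof. by move=> fc; exists f. Qed.

(** * Reductions to the game tree language *)

(** For values at most 2, an even limsup is either 2, taken infinitely often, or 0, the eventual
    constant value. *)
Definition even_limsup (u : nat -> nat) : Prop :=
  unbounded [set k | u k = 2] \/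
  exists N, forall k, (N <= k)%N -> u k = 0.

Lemma is_limsup_even (u : nat -> nat) : (forall k, u k <= 2)%N ->
  (exists m, is_limsup u m /\ ~~ odd m) <-> even_limsup u.
Proof.
move=> u2.
pose U N := [set u k | k in [set k | (N <= k)%N]].
have ubU N c : ubound (U N) c <-> forall k, (N <= k)%N -> (u k <= c)%N.
  split=> [cU k le_k|cU _ [k le_k <-]]; last exact: cU.
  by apply: cU; exists k.
split=> [[m [[s [sup_s [lbm glbm]]] evm]]|].
  (* A least upper bound of a nonempty set of naturals is attained: otherwise its predecessor would
     be an upper bound too. *)
  have s_attained N : exists2 k, (N <= k)%N & u k = s N.
    have [ub_s lub_s] := sup_s N.
    case es : (s N) => [|c].
      by exists N => //; apply/eqP; rewrite -leqn0 -es; move/ubU: ub_s; exact.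
    apply: contrapT => nk; have : (s N <= c)%N.
      apply: lub_s; apply/ubU => k le_k; rewrite -ltnS ltn_neqAle.
      have /ubU/(_ k le_k) := ub_s; rewrite es => ->; rewrite andbT.
      by apply/eqP => uk; apply: nk; exists k.
    by rewrite es ltnn.
  (* The infimum is attained as well: otherwise [m.+1] would be a lower bound. *)
  have [N sN] : exists N, s N = m.
    apply: contrapT => nN; have : (m.+1 <= m)%N.
      apply: glbm => _ [N _ <-]; rewrite leEnat ltn_neqAle; apply/andP; split.
        by apply/eqP => e; apply: nN; exists N.
      by apply: lbm; exists N.
    by rewrite ltnn.
  have u_le k : (N <= k)%N -> (u k <= m)%N.
    by move=> le_k; rewrite -sN; have [/ubU + _] := sup_s N; exact.
  have m2 : (m <= 2)%N by rewrite -sN; have [k _ <-] := s_attained N; exact: u2.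
  case: m m2 evm u_le {glbm sN} lbm => [|[|[|]]] // _ _ u_le lbm.
    by right; exists N => k /u_le; rewrite leqn0 => /eqP.
  left=> N'; have [k le_k uk] := s_attained N'; exists k => //=.
  apply/eqP; rewrite eqn_leq u2 uk /=; apply: lbm; exact: imageT.
case=> [unb|[N uN]].
  exists 2; split=> //; exists (fun=> 2); split.
    move=> N; split; first by apply/ubU => k _; exact: u2.
    by move=> c /ubU cU; have [k le_k <-] := unb N; exact: cU.
  rewrite (_ : range (fun=> 2) = [set 2]) ?infimums1 //.
  by apply/seteqP; split=> [_ [_ _ <-]|_ ->] //; exists 0.
exists 0; split=> //.
have /choice[s sP] n : supremums (U n) !=set0.
  by apply: nat_supremums_neq0; exists 2; apply/ubU => k _; exact: u2.
exists s; split=> //; split=> [x _|c lbc]; first exact: leq0n.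
have sN0 : s N = 0.
  apply/eqP; rewrite -leqn0; apply: (sP N).2.
  by apply/ubU => k /uN ->.
by rewrite -sN0; apply: lbc; exact: imageT.
Qed.

(** Allows the moves made before entering a subtree to be forgotten. *)
Lemma even_limsup_shift n (u : nat -> nat) :
  even_limsup (fun k => u (n + k)) <-> even_limsup u.
Proof.
split=> -[unb|[N uN]].
- left=> N; have [k le_k uk] := unb N; exists (n + k)%N => //.
  by rewrite (leq_trans le_k) ?leq_addl.
- right; exists (n + N)%N => k le_k.
  rewrite -(subnKC (leq_trans (leq_addr _ _) le_k)).
  by apply: uN; rewrite -(leq_add2l n) subnKC // (leq_trans _ le_k) ?leq_addr.
- left=> N; have [k le_k uk] := unb (n + N)%N; exists (k - n)%N.
    by rewrite -(leq_add2l n) subnKC // (leq_trans _ le_k) ?leq_addr.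
  by rewrite /= subnKC // (leq_trans _ le_k) ?leq_addr.
- by right; exists N => k le_k; apply: uN; rewrite (leq_trans le_k) ?leq_addl.
Qed.

(** * Winning strategies and games along a spine *)

Definition winning (sigma : seq bool -> bool) (t : trees Sigma02) : Prop :=
  forall b : nat -> bool,
    (forall k, (t (mkseq b k)).1 = true -> b k = sigma (mkseq b k)) ->
    even_limsup (fun k => (t (mkseq b k)).2).

Lemma W02P t : W02 t <-> exists sigma, winning sigma t.
Proof.
have mk_inj k (b : nat -> bool) c :
    (mkseq b k.+1 = rcons (mkseq b k) c) <-> b k = c.
  by rewrite mkseqS; split=> [/rcons_inj[]|->].
have lim_even b : eve_wins_play t (mkseq b) <->
    even_limsup (fun k => (t (mkseq b k)).2).
  by apply: is_limsup_even => k; rewrite -ltnS.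
split=> -[sigma sigmaP]; exists sigma.
  move=> b bsigma; apply/lim_even/sigmaP; first by apply/branchP; exists b.
  by move=> k /bsigma ?; apply/mk_inj.
move=> v /branchP[b ->] fb; apply/lim_even/sigmaP => k /fb.
exact: (mk_inj _ _ _).1.
Qed.

(* A node that avoids the branch of the [false]s leaves it at a unique
   [nseq k false]; [spine] makes [T k] the subtree hanging there. *)
Definition spine A (g : nat -> A) (T : nat -> seq bool -> A)
    (v : seq bool) : A :=
  if has id v then T (find id v) (drop (find id v).+1 v) else g (size v).

Lemma has_nseq_false k : has id (nseq k false) = false.
Proof. by rewrite has_nseq andbF. Qed.

Lemma spine_nseq A (g : nat -> A) T k : spine g T (nseq k false) = g k.
Proof. by rewrite /spine has_nseq_false size_nseq. Qed.

Lemma spine_cat A (g : nat -> A) T k w :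
  spine g T (nseq k false ++ true :: w) = T k w.
Proof.
rewrite /spine has_cat /= orbT find_cat has_nseq_false /= addn0 size_nseq.
by rewrite -cat1s catA drop_size_cat // size_cat size_nseq addn1.
Qed.

(** A play either turns right at a first spine node and goes on in some [T k], or stays on the spine
    and sees only the priority [c.2]. If Eve owns the spine, [sigma] selects which of these plays
    occur; if Adam does, all of them do. *)
Lemma winning_spine sigma c T :
  winning sigma (spine (fun=> c) T) <->
  (forall k, (c.1 = true -> (forall j, j < k -> ~~ sigma (nseq j false))%N /\
                            sigma (nseq k false)) ->
     winning (fun w => sigma (nseq k false ++ true :: w)) (T k)) /\
  ((c.1 = true -> forall j, ~~ sigma (nseq j false)) ->
     ~~ odd (c.2 : 'I_3)).
Proof.
have mk0 (b : nat -> bool) k : (forall j, (j < k)%N -> b j = false) ->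
    mkseq b k = nseq k false.
  move=> bk; apply: (@eq_from_nth _ false); rewrite size_mkseq ?size_nseq //.
  by move=> i lti; rewrite nth_mkseq // nth_nseq lti bk.
have mk1 (b : nat -> bool) k j : (forall j, (j < k)%N -> b j = false) -> b k ->
    mkseq b (k.+1 + j) =
      nseq k false ++ true :: mkseq (fun i => b (k.+1 + i)) j.
  move=> b0 bk; rewrite /mkseq iotaD map_cat -/(mkseq b k.+1) mkseqS mk0 // bk.
  by rewrite -cats1 -catA /= [in LHS]addnC iotaDl -map_comp.
have lim_cst : even_limsup (fun=> (c.2 : 'I_3)) <-> ~~ odd (c.2 : 'I_3).
  case: (c.2 : 'I_3) => -[|[|[|]]] //= _; split=> //.
  - by right; exists 0.
  - by case=> [unb|[N uN]]; [have [] := unb 0|have := uN N (leqnn N)].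
  - by left=> N; exists N.
split.
  move=> win; split=> [k sk b bT|s0].
    (* The play that walks [k] steps along the spine, turns right and then copies [b]. *)
    pose b' i := if (i < k)%N then false else
                 if i == k then true else b (i - k.+1).
    have b'0 j : (j < k)%N -> b' j = false by rewrite /b' => ->.
    have b'k : b' k by rewrite /b' ltnn eqxx.
    have b'S j : b' (k.+1 + j) = b j.
      have lt_k : (k < k.+1 + j)%N by rewrite addSn ltnS leq_addr.
      by rewrite /b' ltnNge (ltnW lt_k) gtn_eqF //= addKn.
    have b'E : (fun i => b' (k.+1 + i)) = b by apply/funext => j; exact: b'S.
    have : even_limsup (fun k => (spine (fun=> c) T (mkseq b' k)).2).
      apply: win => j; have [lt_j|lt_k|->] := ltngtP j k.
      - rewrite mk0; last by move=> i lti; apply: b'0; exact: ltn_trans lt_j.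
        by rewrite spine_nseq b'0 // => /sk[/(_ j lt_j)/negbTE].
      - rewrite -(subnKC lt_k) mk1 // spine_cat b'E b'S; exact: bT.
      - by rewrite mk0 // spine_nseq b'k => /sk[].
    move=> /(even_limsup_shift k.+1 _).2; congr (even_limsup _).
    by apply/funext => j; rewrite mk1 // spine_cat b'E.
  have : even_limsup (fun k => (spine (fun=> c) T (mkseq (fun=> false) k)).2).
    apply: win => j; rewrite mk0 // spine_nseq => /s0/(_ j)/negbTE.
    by move=> ->.
  move=> h; apply/lim_cst; move: h; congr (even_limsup _).
  by apply/funext => j; rewrite mk0 // spine_nseq.
move=> [winT win0] b bs.
have [[k0 bk0]|b0] := pselect (exists k, b k); last first.
  have {}b0 j : b j = false by apply/negP => bj; apply: b0; exists j.
  have /lim_cst : ~~ odd (c.2 : 'I_3).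
    apply: win0 => c1 j; have := bs j.
    by rewrite mk0 // spine_nseq b0 => /(_ c1) <-.
  by congr (even_limsup _); apply/funext => j; rewrite mk0 // spine_nseq.
case: (ex_minnP (ex_intro (fun k => b k) k0 bk0)) => k bk kmin.
have b0 j : (j < k)%N -> b j = false.
  by move=> lt_j; apply: contraTF lt_j => /kmin; rewrite ltnNge => ->.
apply/(even_limsup_shift k.+1).
have -> : (fun j => (spine (fun=> c) T (mkseq b (k.+1 + j))).2 : nat) =
    fun j => (T k (mkseq (fun i => b (k.+1 + i)) j)).2 : nat.
  by apply/funext => j; rewrite mk1 // spine_cat.
apply: winT => [c1|j].
  split=> [j lt_j|].
    have := bs j; rewrite mk0 ?spine_nseq ?b0 // => [|i lti].
      by move=> /(_ c1) <-.
    by apply: b0; exact: ltn_trans lt_j.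
  by have := bs k; rewrite mk0 // spine_nseq bk => /(_ c1) <-.
by have := bs (k.+1 + j); rewrite mk1 // spine_cat.
Qed.

Definition pr0 : 'I_3 := @Ordinal 3 0 isT.
Definition pr1 : 'I_3 := @Ordinal 3 1 isT.
Definition pr2 : 'I_3 := @Ordinal 3 2 isT.

(** Priority 1 forces Eve to leave the spine, and her first exit is the required [k]. *)
Lemma W02_spine_eve (T : nat -> trees Sigma02) :
  W02 (spine (fun=> (true, pr1)) T) <-> exists k, W02 (T k).
Proof.
split=> [/W02P[sigma /winning_spine[winT win0]]|[k /W02P[sigma win]]].
  have [[k0 sk0]|s0] := pselect (exists k, sigma (nseq k false)); last first.
    suff : ~~ odd pr1 by [].
    by apply: win0 => _ j; apply/negP => sj; apply: s0; exists j.
  pose s_at k := sigma (nseq k false).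
  case: (ex_minnP (ex_intro s_at k0 sk0)) => k sk kmin.
  exists k; apply/W02P; eexists; apply: winT => _; split=> // j.
  by rewrite ltnNge; apply: contra => /kmin.
(* [spine] also glues strategies: on the spine Eve turns right exactly at depth [k], then plays
   [sigma]. *)
apply/W02P; exists (spine (fun j => j == k) (fun=> sigma)).
apply/winning_spine; split=> [j|/(_ erefl k)]; last by rewrite spine_nseq eqxx.
rewrite spine_nseq => /(_ erefl)[_ /eqP->].
by under eq_fun do rewrite spine_cat.
Qed.

(** Adam may exit anywhere, so Eve needs a strategy for every [T k]; priority 0 lets her win if he
    never exits. *)
Lemma W02_spine_adam (T : nat -> trees Sigma02) :
  W02 (spine (fun=> (false, pr0)) T) <-> forall k, W02 (T k).
Proof.
split=> [/W02P[sigma /winning_spine[winT _]] k|W02T].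
  by apply/W02P; eexists; exact: winT.
have /choice[sigma win] k : exists sigma, winning sigma (T k) by exact/W02P.
apply/W02P; exists (spine (fun=> false) sigma).
apply/winning_spine; split=> // k _.
by under eq_fun do rewrite spine_cat; exact: win.
Qed.

Lemma continuous_spine (X : topologicalType) (A : finType) (g : nat -> A)
    (f : nat -> X -> trees A) :
  (forall k, continuous (f k)) ->
  continuous (fun x => spine g (f ^~ x) : trees A).
Proof.
move=> fc; apply: locally_constant_continuous => v; rewrite /spine.
case: (has id v); last exact: locally_constant_cst.
exact: continuous_locally_constant (fc _).
Qed.

Section ReductionsToW02.
Variable X : topologicalType.

Lemma wadge_W02_setT : wadge (@setT X) W02.
Proof.
exists (fun=> fun=> (false, pr0)); split; first by move=> x; exact: cvg_cst.
apply/seteqP; split=> // x _; apply/W02P; exists (fun=> false) => b _ /=.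
by right; exists 0.
Qed.

Lemma wadge_W02_set0 : wadge (@set0 X) W02.
Proof.
exists (fun=> fun=> (false, pr1)); split; first by move=> x; exact: cvg_cst.
apply/seteqP; split=> // x /W02P[sigma /(_ (fun=> false))].
case=> // [unb|[N uN]]; first by have [] := unb 0.
by have := uN N (leqnn N).
Qed.

Lemma wadge_W02_bigcup J (D : set J) (S : J -> set X) : countable D ->
  (forall i, D i -> wadge (S i) W02) -> wadge (\bigcup_(i in D) S i) W02.
Proof.
apply: (countable_bigcup_closed (P := fun S => wadge S W02)).
  exact: wadge_W02_set0.
move=> {}S /choice[f fP]; exists (fun x => spine (fun=> (true, pr1)) (f ^~ x)).
split; first by apply: continuous_spine => k; exact: (fP k).1.
apply/seteqP; split=> x /=.
  by move=> [k _ Sk]; apply/W02_spine_eve; exists k; move: Sk; rewrite (fP k).2.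
by move=> /W02_spine_eve[k Wk]; exists k => //; rewrite (fP k).2.
Qed.

Lemma wadge_W02_bigcap J (D : set J) (S : J -> set X) : countable D ->
  (forall i, D i -> wadge (S i) W02) -> wadge (\bigcap_(i in D) S i) W02.
Proof.
(* The reindexing lemma speaks of unions, so it is applied to the property that the complement
   reduces to [W02]. *)
move=> cD SW; rewrite -(setCK (\bigcap_(i in D) S i)) setC_bigcap.
apply: (countable_bigcup_closed (P := fun S => wadge (~` S) W02)) cD _.
- by rewrite setC0; exact: wadge_W02_setT.
- move=> {SW}S /choice[f fP]; rewrite setC_bigcup.
  exists (fun x => spine (fun=> (false, pr0)) (f ^~ x)).
  split; first by apply: continuous_spine => k; exact: (fP k).1.
  apply/seteqP; split=> x /=.
    by move=> Sx; apply/W02_spine_adam => k; have := Sx k I; rewrite (fP k).2.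
  by move=> /W02_spine_adam Wk k _; rewrite (fP k).2; exact: Wk.
- by move=> i Di; rewrite setCK; exact: SW.
Qed.

End ReductionsToW02.

(** * Reducing analytic and coanalytic sets to [W02] *)

Lemma continuous_relabel (A B : finType) (h : A -> B) :
  continuous (fun t : trees A => (h \o t : trees B)).
Proof.
apply: locally_constant_continuous => v.
exact: locally_constant_comp (locally_constant_eval v).
Qed.

(** Eve alone chooses the branch; letter 1 gets priority 2 and letter 0 priority 1. *)
Lemma wadge_lang_W02 : wadge lang W02.
Proof.
exists (fun t v => (true, if t v then pr2 else pr1)); split.
  exact: (@continuous_relabel _ _ (fun c => (true, if c then pr2 else pr1))).
apply/seteqP; split=> t /=.
  move=> /langP[b unb]; apply/W02P.
  exists (fun v => b (size v)) => b' b'b.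
  have -> : b' = b by apply/funext => k; rewrite b'b // size_mkseq.
  by left=> N; have [k le_k tk] := unb N; exists k => //=; rewrite tk.
move=> /W02P[sigma win]; apply/langP.
(* With no move left to Adam, [sigma] determines a single play, and its branch is the witness. *)
pose fix play k :=
  if k is k'.+1 then rcons (play k') (sigma (play k')) else [::].
pose b k := sigma (play k).
have bE k : mkseq b k = play k by elim: k => // k IHk; rewrite mkseqS IHk.
have [k _|unb|[N uN]] := win b; first by rewrite bE.
  exists b => N; have [k le_k p] := unb N; exists k => //=.
  by move: p => /=; case: (t _).
by have := uN N (leqnn N); case: (t _).
Qed.

(** Adam alone chooses the branch; with priorities 1 and 0, Eve wins when every branch has finitely
    many letters 1. *)
Lemma wadge_langC_W02 : wadge (~` lang) W02.
Proof.
exists (fun t v => (false, if t v then pr1 else pr0)); split.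
  exact: (@continuous_relabel _ _ (fun c => (false, if c then pr1 else pr0))).
apply/seteqP; split=> t /=.
  move=> nt; apply/W02P; exists (fun=> false) => b _; right => /=.
  apply: contrapT => nN; apply: nt; apply/langP; exists b => N.
  apply: contrapT => nk; apply: nN; exists N => k le_k.
  by case tk: (t _) => //; case: nk; exists k.
move=> /W02P[sigma win] /langP[b unb].
have [//|unb2|[N uN]] := win b; first by have [k _ /=] := unb2 0; case: (t _).
by have [k /uN + tk] := unb N; rewrite tk.
Qed.

Lemma wadge_analytic_W02 (Y : finType) (A : set (words Y)) :
  analytic A -> wadge A W02.
Proof.
by move=> /analytic_wadge_lang AL; exact: wadge_trans AL wadge_lang_W02.
Qed.

Lemma wadge_analyticC_W02 (Y : finType) (A : set (words Y)) :
  analytic A -> wadge (~` A) W02.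
Proof.
move=> /analytic_wadge_lang[f [fc ->]].
by apply: wadge_trans wadge_langC_W02; exists f.
Qed.

Lemma Dclass_wadge (eta : countable_ordinal) (X Y : topologicalType)
    (E : set X) (F : set Y) :
  wadge E F -> Dclass eta F -> Dclass eta E.
Proof.
move=> [f [fc ->]] [A [Amon Aan ->]]; exists (fun theta => f @^-1` A theta).
split=> // [theta' theta /Amon sA x|theta]; first exact: sA.
exact: analytic_preimage.
Qed.

(** * The difference hierarchy *)

Section Parity.
Context {d : Order.disp_t} {T : orderType d}.

(** Above the greatest element of [s1] outside [s2], the limit clause of [s2] gives another point of
    [P] outside [s2], which is in [s1] by upward closure: a contradiction. By symmetry the lists
    have the same elements. *)
Lemma limit_plus_inj (P : set T) m1 m2 :
  limit_plus P m1 -> limit_plus P m2 -> m1 = m2.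
Proof.
move=> [s1 [[us1 <-] sP1 up1 lim1]] [s2 [[us2 <-] sP2 up2 lim2]].
have sub (s s' : seq T) : (forall x, x \in s -> P x) ->
    (forall x y, x \in s -> P y -> (x < y)%O -> y \in s) ->
    (forall x, P x -> x \notin s' ->
      exists y, [/\ P y, y \notin s' & (x < y)%O]) ->
    {subset s <= s'}.
  move=> sP ups lims' x0 sx0; apply: contraT => s'x0.
  pose D : seq T := [seq x <- s | x \notin s'].
  have sorted_D : sorted (>=%O) (sort (>=%O) D).
    by apply: sort_sorted; exact: ge_total.
  case eD : (sort (>=%O) D) sorted_D => [|x D'] /=.
    have : x0 \in sort (>=%O) D by rewrite mem_sort mem_filter s'x0.
    by rewrite eD.
  rewrite path_sortedE; last exact: ge_trans.
  move=> /andP[/allP xmax _].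
  have : x \in D by rewrite -(mem_sort (>=%O)) eD mem_head.
  rewrite mem_filter => /andP[s'x sx].
  have [y [Py s'y lt_xy]] := lims' x (sP x sx) s'x.
  have : y \in sort (>=%O) D by rewrite mem_sort mem_filter s'y (ups x).
  rewrite eD inE => /predU1P[eyx|/xmax /=]; first by rewrite eyx ltxx in lt_xy.
  by rewrite leNgt lt_xy.
apply/eqP; rewrite eqn_leq; apply/andP.
by split; apply: uniq_leq_size => //; exact: sub.
Qed.

Lemma odd_typeP (P : set T) m : limit_plus P m -> odd_type P <-> odd m.
Proof.
move=> Pm; split=> [oddP|odd_m [m' [ev /(limit_plus_inj Pm) e]]].
  by apply: contraT => ev; case: oddP; exists m.
by rewrite e (negbTE ev) in odd_m.
Qed.

End Parity.

(** Here [m] is 0: raising the leading coordinate of a tuple gives a larger one, so there is no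
    greatest. *)
Lemma even_type_omega_pow n : (1 <= n)%N -> even_type [set: omega_pow n].
Proof.
case: n => // n _; exists 0; split=> //; exists [::]; split=> // x _ _.
case/tupleP: x => a s.
exists (cons_tuple a.+1 s : omega_pow n.+1); split=> //.
suff : (a :: s < a.+1 :: s :> seqlexi nat)%O by [].
by rewrite ltxi_cons leEnat leqnSn ltnn.
Qed.

Definition omega1 (m : nat) : omega_pow 1 := [tuple m].

Lemma omega1_lt m k : (omega1 m < omega1 k)%O = (m < k)%N.
Proof.
have -> : (omega1 m < omega1 k)%O = ([:: m] < [:: k] :> seqlexi nat)%O by [].
by rewrite ltxi_cons ltxx implybF -ltNge andb_idl // => /ltW.
Qed.

Lemma omega1P (a : omega_pow 1) : exists m, a = omega1 m.
Proof.
case/tupleP: a => m s; exists m.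
by rewrite (tuple0 s); apply: val_inj.
Qed.

Lemma odd_type_omega1 m : odd_type (segment (omega1 m)) <-> odd m.
Proof.
(* The segment is finite, so its limit part is empty and all [m] points go into the list. *)
apply: odd_typeP; exists [seq omega1 k | k <- iota 0 m].
have mem_seg k : (omega1 k \in [seq omega1 k | k <- iota 0 m]) = (k < m)%N.
  by rewrite mem_map ?mem_iota // => i j [].
split.
- by rewrite map_inj_uniq ?iota_uniq ?size_map ?size_iota // => i j [].
- move=> x /mapP[k]; rewrite mem_iota => lt_k ->.
  by rewrite /segment /= omega1_lt.
- move=> x y _; have [k ->] := omega1P y.
  by rewrite mem_seg /segment /= omega1_lt.
- move=> x; have [k ->] := omega1P x.
  by rewrite mem_seg /segment /= omega1_lt => ->.
Qed.

(** Makes the case [n = 1] an instance of the general one, so that later proofs need no case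
    distinction. *)
Lemma langn_ge2 n : langn n = lang_ge2 n.
Proof.
rewrite /langn; case: eqP => // ->.
have adE m : address (omega1 m : 1.-tuple nat) = rcons (nseq m false) true.
  by rewrite [address _]address_cons cats1.
apply/seteqP; split=> t.
  move=> [m [Lm mmin oddm]]; exists (omega1 m); rewrite adE; split.
    by split=> //; apply/odd_type_omega1.
  move=> b; have [k ->] := omega1P b; rewrite omega1_lt adE ltnNge => nle /mmin.
  by rewrite (negbTE nle).
move=> [a]; have [m ->] := omega1P a.
rewrite adE => -[[Lm /odd_type_omega1 oddm] lt_m].
exists m; split=> // k Lk; rewrite leqNgt; apply/negP => lt_k.
by apply: (lt_m (omega1 k)); rewrite ?omega1_lt // adE.
Qed.

Lemma continuous_subtree (S : finType) u : continuous (@subtree S ^~ u).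
Proof.
by apply: locally_constant_continuous => v; exact: locally_constant_eval.
Qed.

(** * The languages [langn] in the difference hierarchy *)

Definition lang_at n (a : omega_pow n) : set (trees bool) :=
  (@subtree bool ^~ (address (a : n.-tuple nat))) @^-1` lang.

(** Taking unions over [b <= a] makes the sequence increasing without moving the least index at
    which a tree occurs; as the type of [omega_pow n] is even, [Dset] selects the odd indices. *)
Lemma langn_Dset n : (1 <= n)%N ->
  langn n = Dset (fun a : omega_pow n =>
    \bigcup_(b in [set b | (b <= a)%O]) lang_at b).
Proof.
move=> /even_type_omega_pow even_n; rewrite langn_ge2.
apply/seteqP; split=> t [a].
  move=> [[La odd_a] min_a]; exists a; split; first by exists a => //=.
    move=> b lt_b [c /= le_c Lc]; exact: min_a (le_lt_trans le_c lt_b) Lc.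
  by split.
move=> [[b /= le_b Lb] min_a even_a]; exists a; split.
  split; last by apply/even_a.
  move: le_b; rewrite le_eqVlt => /predU1P[<- //|lt_b].
  by case: (min_a b lt_b); exists b => /=.
by move=> c lt_c Lc; apply: (min_a c lt_c); exists c => /=.
Qed.

Lemma langn_Dclass n : (1 <= n)%N -> Dclass (omega_pow n) (langn n).
Proof.
move=> n1; eexists; split; last exact: langn_Dset.
  move=> a' a le_a t [b /= le_b Lb]; exists b => //=; exact: le_trans le_b le_a.
move=> a; apply: analytic_bigcup.
  exact: sub_countable (subset_card_le (@subsetT _ _)) (ord_countable _).
move=> b _; apply: analytic_preimage lang_analytic; exact: continuous_subtree.
Qed.

Lemma wadge_langn (n : nat) (Y : finType) (E : set (words Y)) : (1 <= n)%N ->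
  Dclass (omega_pow n) E -> wadge E (langn n).
Proof.
move=> n1 [A [_ Aan ->]].
have /choice[f fP] a := analytic_wadge_lang (Aan a).
(* At most one [n]-tuple has an address that is a prefix of [v], so the trees [f a x] do not
   interfere; labels elsewhere are 0. *)
pose g (x : words Y) : trees bool := fun v =>
  `[< exists (a : omega_pow n) w,
        v = address (a : n.-tuple nat) ++ w /\ f a x w = true >].
have gE x (a : omega_pow n) w : g x (address (a : n.-tuple nat) ++ w) = f a x w.
  apply/asboolP/idP => [[b [w' [e fb]]]|fa]; last by exists a, w.
  have [|/val_inj eab eww] := address_inj e; first by rewrite !size_tuple.
  by rewrite eab eww fb.
exists g; split.
  apply: locally_constant_continuous => v.
  have [[a [w ->]]|nv] := pselect
      (exists (a : omega_pow n) w, v = address (a : n.-tuple nat) ++ w).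
    have -> : (fun x => g x (address (a : n.-tuple nat) ++ w)) =
        (fun x => f a x w).
      by apply/funext => x; exact: gE.
    by apply: continuous_locally_constant; exact: (fP a).1.
  have -> : (fun x => g x v) = (fun=> false).
    apply/funext => x; apply/asboolP => -[a [w [e _]]]; apply: nv.
    by exists a, w.
  exact: locally_constant_cst.
rewrite langn_ge2.
have LE a x : lang (subtree (g x) (address (a : n.-tuple nat))) = A a x.
  rewrite (fP a).2 /=; congr lang; apply/funext => w; exact: gE.
have even_n := even_type_omega_pow n1.
apply/seteqP; split=> x /=.
  move=> [a [Aa min_a par_a]]; exists a; rewrite LE; split.
    by split=> //; apply/par_a.
  by move=> b /min_a; rewrite LE.
move=> [a [[]]]; rewrite LE => Aa odd_a min_a; exists a; split=> //.
by move=> b /min_a; rewrite LE.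
Qed.

Lemma langn_wadge_W02 n : wadge (langn n) W02.
Proof.
have countable_omega (D : set (omega_pow n)) : countable D.
  exact: sub_countable (subset_card_le (@subsetT _ D)) (ord_countable _).
(* Eve claims an odd [a]; Adam challenges membership at [a] or non-membership at a smaller [b]. *)
have -> : langn n = \bigcup_(a in [set a : omega_pow n | odd_type (segment a)])
    \bigcap_(b in [set b : omega_pow n | (b <= a)%O])
      (if b == a then lang_at b else ~` lang_at b).
  rewrite langn_ge2; apply/seteqP; split=> t.
    move=> [a [[La odd_a] min_a]]; exists a => // b /=.
    by rewrite le_eqVlt; case: eqP => [->|_ /= /min_a].
  move=> [a /= odd_a La]; exists a; split.
    by split=> //; have := La a (lexx a); rewrite eqxx.
  by move=> b lt_b; have := La b (ltW lt_b); rewrite lt_eqF.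
apply: wadge_W02_bigcup => // a _; apply: wadge_W02_bigcap => // b _.
have sc := @continuous_subtree bool (address (b : n.-tuple nat)).
case: eqP => _.
  exact: wadge_trans (wadge_preimage _ sc) wadge_lang_W02.
exact: wadge_trans (wadge_preimage (~` lang) sc) wadge_langC_W02.
Qed.

(** * Diagonalization against the difference hierarchy *)

Lemma W02_not_Dclass (eta : countable_ordinal) : ~ Dclass eta W02.
Proof.
move=> DW.
have /countable_injP[g] := ord_countable eta.
move=> /in2TT g_inj.
pose X : topologicalType := (words bool * baire_space)%type.
(* A word codes an [eta]-sequence of closed sets by marking the pairs of prefixes it admits for each
   [theta]; [C0] tests a word against the sets it codes itself. *)
pose code (theta : eta) k (z : X) : nat :=
  pickle (g theta, mkseq z.1 k, mkseq z.2 k).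
pose C0 theta : set X := [set z | forall k, z.1 (code theta k z) = true].
pose U theta : set (words bool) := [set x | exists y, C0 theta (x, y)].
have Uan theta : analytic (U theta).
  exists (C0 theta); split=> //; apply: closed_forall => k.
  apply: (@locally_constant_bind X _ _ (code theta k)
    (fun c z => z.1 c = true)).
    have lc1 : locally_constant (fun z : X => mkseq z.1 k).
      apply: (@locally_constant_mkseq X _ (fun i z => z.1 i)) => i.
      exact: locally_constant_fst.
    have lc2 : locally_constant (fun z : X => mkseq z.2 k).
      apply: (@locally_constant_mkseq X _ (fun i z => z.2 i)) => i.
      exact: locally_constant_snd.
    move=> z; apply: filterS2 (lc1 z) (lc2 z) => z' /= e1 e2.
    by rewrite /code e1 e2.
  move=> c; apply: (@locally_constant_comp X _ _ (fun c => c = true)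
    (fun z => z.1 c)).
  exact: locally_constant_fst.
have countable_eta (D : set eta) : countable D.
  exact: sub_countable (subset_card_le (@subsetT _ D)) (ord_countable _).
(* Being outside [Dset U] means that each [a] of the selected parity is refuted, by missing [U a] or
   by lying in an earlier [U b]. *)
have EW : wadge (~` Dset U) W02.
  have -> : ~` Dset U = \bigcap_(a in [set a : eta |
        odd_type (segment a) <-> even_type [set: eta]])
      \bigcup_(b in [set b : eta | (b <= a)%O])
        (if b == a then ~` U b else U b).
    apply/seteqP; split=> x.
      move=> nDx a /= par_a; apply: contrapT => nUx; apply: nDx.
      exists a; split=> //.
        by apply: contrapT => nUa; apply: nUx; exists a => /=; rewrite ?eqxx.
      by move=> b lt_b Ub; apply: nUx; exists b => /=; rewrite ?lt_eqF ?ltW.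
    move=> Ux [a [Ua min_a par_a]]; have [b /=] := Ux a par_a.
    by rewrite le_eqVlt; case: eqP => [->|_ /= /min_a].
  apply: wadge_W02_bigcap => // a _; apply: wadge_W02_bigcup => // b _.
  by case: eqP => _; [exact: wadge_analyticC_W02|exact: wadge_analytic_W02].
have [A [_ Aan EA]] := Dclass_wadge EW DW.
have /choice[C CP] := Aan.
pose x0 : words bool := fun c =>
  `[< exists theta k z, C theta z /\ c = code theta k z >].
have UA theta : U theta x0 <-> A theta x0.
  rewrite (CP theta).2; split=> -[y]; last first.
    by move=> Cy; exists y => k; apply/asboolP; exists theta, k, (x0, y).
  move=> C0y; exists y; apply: (closed_agree (C := C theta) (CP theta).1) => k.
  have /asboolP[theta' [k' [z [Cz]]]] := C0y k.
  move=> /(pcan_inj (@pickleK _))[/g_inj eth e1 e2]; rewrite -{theta'}eth in Cz.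
  (* Equal codes carry prefixes of equal length. *)
  have kk' : k = k' by rewrite -(size_mkseq x0 k) e1 size_mkseq.
  rewrite -{k'}kk' in e1 e2; exists z; split=> // i lti.
    by rewrite -(nth_mkseq (x0 i) z.1 lti) -e1 nth_mkseq.
  by rewrite -(nth_mkseq (y i) z.2 lti) -e2 nth_mkseq.
have DUA : Dset U x0 <-> Dset A x0.
  split=> -[a [/UA Aa min_a par_a]]; exists a; split=> //.
    by move=> b /min_a nUb /UA.
  by move=> b /min_a nUb /UA.
have nDU : ~ Dset U x0.
  by move=> DU; have : (~` Dset U) x0 by rewrite EA; apply/DUA.
by apply: (nDU); apply/DUA; rewrite -EA.
Qed.

Theorem theorem5p8 :
  (forall n : nat, (1 <= n)%N ->
     Dcomplete (omega_pow n) (langn n) /\ wadge (langn n) W02) /\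
  (forall alpha : countable_ordinal, lt_omega_omega alpha ->
     ~ Dclass alpha W02).
Proof.
split=> [n n1|alpha _]; last exact: W02_not_Dclass.
split; last exact: langn_wadge_W02.
move=> Y E; split; first exact: wadge_langn.
by move=> EL; exact: Dclass_wadge EL (langn_Dclass n1).
Qed.
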